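(* Let $\mathcal{G}(y)$, $y\in\mathcal{Y}$, be the parametrized family of $N$-player network aggregative games described in the context, with operator $F(x,y)=[\nabla_{x^i}J^i(x^i,z^i(x),y^i)^\top]_{i=1}^N$. Suppose that: (A1) (Constraints) for each $i$, $\mathcal{X}^i=\{x^i\in\mathbb{R}^n\mid B^ix^i\le b^i,\ H^ix^i=h^i\}$ for some $B^i\in\mathbb{R}^{m_i\times n}$, $b^i\in\mathbb{R}^{m_i}$, $H^i\in\mathbb{R}^{p_i\times n}$, $h^i\in\mathbb{R}^{p_i}$, and there exists $x^i\in\mathcal{X}^i$ with $B^ix^i<b^i$ (componentwise); (A2) (Cost functions) for all $i$ and all $y^i\in\mathcal{Y}^i$, the function $x^i\mapsto J^i(x^i,z^i(x),y^i)$ is twice continuously differentiable and strongly convex in $x^i$ for all $x^{-i}\in\mathcal{X}^{-i}=\prod_{j\ne i}\mathcal{X}^j$; moreover $[x^i;z^i]\mapsto J^i(x^i,z^i,y^i)$ is twice continuously differentiable in $[x^i;z^i]$. Then the operator $x\mapsto F(x,y)$ is continuously differentiable in $x$. Suppose additionally that for a given $y\in\mathcal{Y}$ $$\alpha(y):=\min_{x\in\mathcal{X}}\big(\kappa_1(x,y)-\kappa_2(x,y)\,w(P)\big)>0,$$ where $$\kappa_1(x,y):=\min_i\ \lambda_{\min}\big(\nabla^2_{x^i}J^i(x^i,z^i,y^i)|_{z^i=z^i(x)}\big),\qquad \kappa_2(x,y):=\max_i\ \big\|\nabla^2_{x^iz^i}J^i(x^i,z^i,y^i)|_{z^i=z^i(x)}\big\|,$$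 and 1. $w(P)=|\lambda_{\min}(P)|$ if both (a) $P=P^\top$ and (b) $\nabla^2_{x^iz^i}J^i(x^i,z^i,y^i)|_{z^i=z^i(x)}=\kappa_2(x,y)I_n$ for all $i$ and all $x\in\mathcal{X}$; 2. $w(P)=\|P\|$ otherwise. Then $x\mapsto F(x,y)$ is strongly monotone in $\mathcal{X}$, with monotonicity constant $\alpha(y)$.
   Context: Setting. There are $N$ players interacting over a network with non-negative adjacency matrix $P\in\mathbb{R}^{N\times N}$, $P_{ii}=0$ for all $i$. Player $i$ selects a strategy $x^i\in\mathcal{X}^i\subseteq\mathbb{R}^n$ to minimize the real-valued cost $J^i(x^i,z^i(x),y^i)$, where $z^i(x):=\sum_{j=1}^N P_{ij}x^j\in\mathbb{R}^n$ and $y^i\in\mathcal{Y}^i\subseteq\mathbb{R}^{d_i}$ is a parameter. Here $J^i$ is a function of $(x^i,z^i,y^i)\in\mathbb{R}^n\times\mathbb{R}^n\times\mathcal{Y}^i$. Notation: $x:=[x^i]_{i=1}^N\in\mathbb{R}^{Nn}$ and $y:=[y^i]_{i=1}^N$ are stacked vectors, $\mathcal{X}:=\mathcal{X}^1\times\dots\times\mathcal{X}^N$, $\mathcal{Y}:=\mathcal{Y}^1\times\dots\times\mathcal{Y}^N$. For $y\in\mathcal{Y}$ the resulting game is denoted $\mathcal{G}(y)$ (a network aggregative game). Operator: $F(x,y):=[\nabla_{x^i}J^i(x^i,z^i(x),y^i)^\top]_{i=1}^N\in\mathbb{R}^{Nn}$, the stacked gradients of each player's cost with respect to the player's own strategy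 (since $P_{ii}=0$, $z^i(x)$ does not depend on $x^i$). $\nabla^2_{x^i}J^i(x^i,z^i,y^i)$ is the Hessian of $J^i$ with respect to $x^i$, and $\nabla^2_{x^iz^i}J^i(x^i,z^i,y^i)$ is the Jacobian of $\nabla_{x^i}J^i(x^i,z^i,y^i)^\top$ with respect to $z^i$. $\lambda_{\min}$ denotes the smallest eigenvalue (of a symmetric matrix) and $\|\cdot\|$ the Euclidean operator norm (2-norm) of matrices. Strong monotonicity: a continuously differentiable operator $f$ is strongly monotone in $\mathcal{X}$ with constant $\alpha>0$ if $(f(x_1)-f(x_2))^\top(x_1-x_2)\ge\alpha\|x_1-x_2\|^2$ for all $x_1,x_2\in\mathcal{X}$, and, in the form which the paper treats as equivalent, $\tfrac12(\nabla_xf(x)+\nabla_xf(x)^\top)\succeq\alpha I$ for all $x\in\mathcal{X}$; both forms are understood to hold. *)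

(* Defs.v *)
From HB Require Import structures.
From mathcomp Require Import all_boot all_order all_algebra.
From mathcomp Require Import all_classical all_reals all_analysis.

Set Implicit Arguments.
Unset Strict Implicit.
Unset Printing Implicit Defensive.
Import Order.TTheory GRing.Theory Num.Theory.
Import numFieldNormedType.Exports.
Local Open Scope classical_set_scope.
Local Open Scope ring_scope.

(* Vectors of R^m are row vectors.  The norm that the library puts on 'rV[R]_m
   is the sup norm; it induces the usual topology, hence the usual
   differentials, but quantitative statements need the Euclidean norm below. *)

Section euclidean.
Variable R : realType.

Definition dot m (u v : 'rV[R]_m) : R := \sum_(k < m) u ord0 k * v ord0 k.

Definition enorm m (u : 'rV[R]_m) : R := Num.sqrt (dot u u).

(* v *m A^T is the column vector A v, written as a row. *)
Definition opnorm m p (A : 'M[R]_(m, p)) : R :=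
  sup [set enorm (v *m A^T) | v in [set v : 'rV[R]_p | enorm v <= 1]].

(* The set of real eigenvalues is finite, and it is nonempty when A is symmetric
   of positive size: the infimum is then a minimum. *)
Definition lambda_min m (A : 'M[R]_m) : R :=
  inf [set a : R | eigenvalue A a].

(* Loewner order A >= B, between symmetric matrices *)
Definition loewner_ge m (A B : 'M[R]_m) : Prop :=
  forall v : 'rV[R]_m, 0 <= dot (v *m (A - B)) v.

End euclidean.

Section calculus.
Variable R : realType.

Definition grad m (g : 'rV[R]_m -> R^o) (x : 'rV[R]_m) : 'rV[R]_m :=
  \row_(k < m) 'D_(delta_mx ord0 k) g x.

(* The library's jacobian acts on row vectors on the right; its transpose is the
   usual Jacobian, with entry (k, l) the partial derivative of f_k along l. *)
Definition Jac m p (f : 'rV[R]_m -> 'rV[R]_p) (x : 'rV[R]_m) : 'M[R]_(p, m) :=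
  (jacobian f x)^T.

Definition hessian m (g : 'rV[R]_m -> R^o) (x : 'rV[R]_m) : 'M[R]_m :=
  Jac (grad g) x.

Definition C1 m p (f : 'rV[R]_m -> 'rV[R]_p) : Prop :=
  (forall x, differentiable f x) /\ continuous (Jac f).

Definition C2 m (g : 'rV[R]_m -> R^o) : Prop :=
  (forall x, differentiable g x) /\ C1 (grad g).

Definition strongly_convex_on m (D : set 'rV[R]_m) (g : 'rV[R]_m -> R) : Prop :=
  exists mu : R, 0 < mu /\
    forall (u v : 'rV[R]_m) (t : R), D u -> D v -> 0 <= t <= 1 ->
      g (t *: u + (1 - t) *: v) <=
      t * g u + (1 - t) * g v - mu / 2 * t * (1 - t) * enorm (u - v) ^+ 2.

(* Both the incremental and the differential form are required. *)
Definition strongly_monotone m (D : set 'rV[R]_m) (f : 'rV[R]_m -> 'rV[R]_m)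
    (alpha : R) : Prop :=
  [/\ 0 < alpha,
      forall x1 x2, D x1 -> D x2 ->
        alpha * enorm (x1 - x2) ^+ 2 <= dot (f x1 - f x2) (x1 - x2)
    & forall x, D x ->
        loewner_ge (2^-1 *: (Jac f x + (Jac f x)^T)) alpha%:M].

End calculus.

Section game.
Variables (R : realType) (N n : nat).

(* A strategy profile is the stacked vector x = [x^i]_i of R^(N n); block x i is
   the strategy x^i. *)
Definition block (x : 'rV[R]_(N * n)) (i : 'I_N) : 'rV[R]_n := row i (vec_mx x).

Definition stack (u : 'I_N -> 'rV[R]_n) : 'rV[R]_(N * n) :=
  mxvec (\matrix_(i < N) u i).

Definition aggregate (P : 'M[R]_N) (x : 'rV[R]_(N * n)) (i : 'I_N) : 'rV[R]_n :=
  \sum_(j < N) P i j *: block x j.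

Definition profiles (X : 'I_N -> set 'rV[R]_n) : set 'rV[R]_(N * n) :=
  [set x | forall i, X i (block x i)].

Definition polyhedral (X : 'I_N -> set 'rV[R]_n) : Prop :=
  forall i, exists (m p : nat) (B : 'M[R]_(m, n)) (b : 'cV[R]_m)
    (H : 'M[R]_(p, n)) (h : 'cV[R]_p),
    X i = [set u | (forall k, (B *m u^T) k ord0 <= b k ord0) /\ H *m u^T = h] /\
    exists2 u, X i u & forall k, (B *m u^T) k ord0 < b k ord0.

Variables (P : 'M[R]_N) (X : 'I_N -> set 'rV[R]_n).
Variables (d : 'I_N -> nat) (Y : forall i, set 'rV[R]_(d i)).
Variable J : forall i : 'I_N, 'rV[R]_n -> 'rV[R]_n -> 'rV[R]_(d i) -> R.

(* P i i = 0, so that aggregate P x i does not depend on block x i: it is a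
   constant when the strategy u of player i varies, and in the first clause x
   only carries the strategies of the other players. *)
Definition regular_costs : Prop :=
  forall (i : 'I_N) (yi : 'rV[R]_(d i)), Y yi ->
    (forall x : 'rV[R]_(N * n), (forall j, j != i -> X j (block x j)) ->
       C2 (fun u => J u (aggregate P x i) yi) /\
       strongly_convex_on (X i) (fun u => J u (aggregate P x i) yi)) /\
    C2 (fun w : 'rV[R]_(n + n) => J (lsubmx w) (rsubmx w) yi).

Variable y : forall i : 'I_N, 'rV[R]_(d i).

Definition game_operator (x : 'rV[R]_(N * n)) : 'rV[R]_(N * n) :=
  stack (fun i => grad (fun u => J u (aggregate P x i) (y i)) (block x i)).

Definition hess_xx (x : 'rV[R]_(N * n)) (i : 'I_N) : 'M[R]_n :=
  hessian (fun u => J u (aggregate P x i) (y i)) (block x i).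

Definition hess_xz (x : 'rV[R]_(N * n)) (i : 'I_N) : 'M[R]_n :=
  Jac (fun z => grad (fun u => J u z (y i)) (block x i)) (aggregate P x i).

(* Infimum and supremum of a nonempty finite family *)
Definition kappa1 (x : 'rV[R]_(N * n)) : R :=
  inf (range (fun i : 'I_N => lambda_min (hess_xx x i))).

Definition kappa2 (x : 'rV[R]_(N * n)) : R :=
  sup (range (fun i : 'I_N => opnorm (hess_xz x i))).

Definition network_weight : R :=
  if `[< P = P^T /\
         forall i x, profiles X x -> hess_xz x i = (kappa2 x)%:M >]
  then `|lambda_min P| else opnorm P.

(* The infimum is the minimum whenever the latter exists; inf is 0 on a set
   without lower bound, so that 0 < alpha_const excludes that case. *)
Definition alpha_const : R :=
  inf [set kappa1 x - kappa2 x * network_weight | x in profiles X].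

End game.

(* Main.v *)
From HB Require Import structures.
Require Import Defs.
From mathcomp Require Import all_boot all_order all_algebra.
From mathcomp Require Import all_classical all_reals all_analysis.
From mathcomp Require Import ring lra.
Import Order.TTheory GRing.Theory Num.Theory.
Import numFieldNormedType.Exports.
Local Open Scope classical_set_scope.
Local Open Scope ring_scope.

(* The operator F is a sum of the gradients of the joint costs
   [x^i; z^i] |-> J^i, composed with linear maps on both sides, hence C^1.  Its
   Jacobian at x has the quadratic form
     v |-> sum_i <H_i v_i, v_i> + sum_ij P_ij <K_i v_j, v_i>,
   where H_i is the Hessian in x^i and K_i the mixed derivative.  The first sum
   is at least kappa_1 |v|^2, by the Rayleigh quotient and the symmetry of H_i.
   Since P >= 0, the second one is at least
     - kappa_2 sum_ij P_ij |v_i| |v_j| >= - kappa_2 ||P|| |v|^2;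
   when K_i = kappa_2 I, it is kappa_2 times the form of P evaluated at each of
   the n coordinates.  The mean value theorem on segments of the convex set X turns this
   bound on the Jacobian into the incremental form of strong monotonicity. *)

(** * The Euclidean structure and quadratic forms *)

Lemma dot_mx {R : realType} {m} (u v : 'rV[R]_m) : dot u v = (u *m v^T) ord0 ord0.
Proof. by rewrite mxE; apply: eq_bigr => k _; rewrite mxE. Qed.

Lemma dotC {R : realType} {m} (u v : 'rV[R]_m) : dot u v = dot v u.
Proof. by apply: eq_bigr => k _; rewrite mulrC. Qed.

Lemma dotDl {R : realType} {m} (u v w : 'rV[R]_m) : dot (u + v) w = dot u w + dot v w.
Proof. by rewrite !dot_mx mulmxDl mxE. Qed.

Lemma dotZl {R : realType} {m} a (u w : 'rV[R]_m) : dot (a *: u) w = a * dot u w.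
Proof. by rewrite !dot_mx -scalemxAl mxE. Qed.

Lemma dotNl {R : realType} {m} (u w : 'rV[R]_m) : dot (- u) w = - dot u w.
Proof. by rewrite -scaleN1r dotZl mulN1r. Qed.

Lemma dotBl {R : realType} {m} (u v w : 'rV[R]_m) : dot (u - v) w = dot u w - dot v w.
Proof. by rewrite dotDl dotNl. Qed.

Lemma dotDr {R : realType} {m} (w u v : 'rV[R]_m) : dot w (u + v) = dot w u + dot w v.
Proof. by rewrite dotC dotDl !(dotC w). Qed.

Lemma dotZr {R : realType} {m} a (w u : 'rV[R]_m) : dot w (a *: u) = a * dot w u.
Proof. by rewrite dotC dotZl dotC. Qed.

Lemma dot0l {R : realType} {m} (w : 'rV[R]_m) : dot 0 w = 0.
Proof. by rewrite dot_mx mul0mx mxE. Qed.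

Lemma dot_suml {R : realType} {m} {I : finType} (u : I -> 'rV[R]_m) w :
  dot (\sum_i u i) w = \sum_i dot (u i) w.
Proof.
rewrite dot_mx mulmx_suml summxE; apply: eq_bigr => i _.
by rewrite dot_mx.
Qed.

Lemma dot_mulmx {R : realType} {m p} (A : 'M[R]_(m, p)) u v :
  dot (u *m A) v = dot u (v *m A^T).
Proof. by rewrite !dot_mx trmx_mul trmxK mulmxA. Qed.

Lemma dot_ge0 {R : realType} {m} (u : 'rV[R]_m) : 0 <= dot u u.
Proof. by apply: sumr_ge0 => k _; rewrite -expr2 sqr_ge0. Qed.

Lemma dot_eq0 {R : realType} {m} (u : 'rV[R]_m) : dot u u = 0 -> u = 0.
Proof.
move=> /eqP; rewrite psumr_eq0 => [/allP u0|k _]; last by rewrite -expr2 sqr_ge0.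
apply/rowP => k; rewrite mxE; apply/eqP.
by have := u0 k (mem_index_enum k); rewrite /= mulf_eq0 orbb.
Qed.

Lemma sqr_enorm {R : realType} {m} (u : 'rV[R]_m) : enorm u ^+ 2 = dot u u.
Proof. by rewrite sqr_sqrtr ?dot_ge0. Qed.

Lemma enorm_ge0 {R : realType} {m} (u : 'rV[R]_m) : 0 <= enorm u.
Proof. exact: sqrtr_ge0. Qed.

Lemma enormZ {R : realType} {m} a (u : 'rV[R]_m) : enorm (a *: u) = `|a| * enorm u.
Proof. by rewrite /enorm dotZl dotZr mulrA -expr2 sqrtrM ?sqr_ge0// sqrtr_sqr. Qed.

Lemma enorm_gt0 {R : realType} {m} (u : 'rV[R]_m) : u != 0 -> 0 < enorm u.
Proof.
move=> u0; rewrite sqrtr_gt0 lt_neqAle dot_ge0 andbT eq_sym.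
by apply: contra u0 => /eqP/dot_eq0 ->.
Qed.

(** Cauchy-Schwarz: with b = <v, v>, a = <u, u>, c = <u, v>, the vector b u - c v has square norm b
    (a b - c^2), and b can be divided out when v is nonzero. *)
Lemma dot_le_enorm {R : realType} {m} (u v : 'rV[R]_m) :
  `|dot u v| <= enorm u * enorm v.
Proof.
rewrite -ler_sqr ?nnegrE ?mulr_ge0 ?enorm_ge0// exprMn !sqr_enorm real_normK ?num_real//.
have [v0|v0] := eqVneq (dot v v) 0.
  by rewrite (dot_eq0 _ v0) dotC dot0l expr0n mulr_ge0 ?dot_ge0.
have := dot_ge0 (dot v v *: u - dot u v *: v).
rewrite -scaleNr !(dotDl, dotDr, dotZl, dotZr) (dotC v u).
have : 0 < dot v v by rewrite lt_neqAle eq_sym v0 dot_ge0.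
move: (dot v v) (dot u u) (dot u v) {v0} => b a c b0 H.
have : 0 <= b * (a * b - c ^+ 2) by apply: le_trans H _; lra.
by rewrite pmulr_rge0// subr_ge0.
Qed.

(* Perturb v in the direction of - v A. *)
Lemma psd_ker {R : realType} {m} (A : 'M[R]_m) (v : 'rV[R]_m) :
  A^T = A -> (forall u, 0 <= dot (u *m A) u) -> dot (v *m A) v = 0 -> v *m A = 0.
Proof.
move=> As Ap v0; apply: dot_eq0; apply/eqP; rewrite eq_le dot_ge0 andbT.
set w := v *m A; pose q := dot (w *m A) w.
have q0 : 0 <= q by exact: Ap.
(* With c = [dot w w], these weights give the form the value - c^2 (2 + q), which is negative unless
   c = 0. *)
have := Ap ((1 + q) *: v - dot w w *: w).
rewrite -scaleNr mulmxDl -!scalemxAl !(dotDl, dotDr, dotZl, dotZr) v0.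
have -> : dot (w *m A) v = dot w w by rewrite dot_mulmx As.
rewrite -/w -/q.
move: (dot w w) (dot_ge0 w) q q0 => c c0 q q0 H.
rewrite leNgt; apply/negP => c1.
have : 0 < c ^+ 2 * (2 + q) by rewrite mulr_gt0 ?exprn_gt0//; lra.
by lra.
Qed.


(** * Continuity of linear maps, the Rayleigh quotient and the operator norm *)

Lemma linear_mx_continuous {R : realType} {m n} {V : normedModType R}
  (f : {linear 'M[R]_(m, n) -> V}) : continuous f.
Proof.
have -> : (f : _ -> V) = (fun A => \sum_i \sum_j (A i j) *: f (delta_mx i j)).
  apply/funext => A; rewrite {1}[A]matrix_sum_delta linear_sum; apply: eq_bigr => i _.
  by rewrite linear_sum; apply: eq_bigr => j _; rewrite linearZ.
move=> A; have FA : Filter (nbhs A) by exact: nbhs_filter.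
apply: (cvg_big add_continuous) => i _; apply: (cvg_big add_continuous) => j _.
by apply: cvgZr_tmp; exact: coord_continuous.
Qed.

Lemma dot_continuous {R : realType} {T : topologicalType} {p} (f g : T -> 'rV[R]_p) :
  continuous f -> continuous g -> continuous (fun u => dot (f u) (g u)).
Proof.
move=> cf cg u; have Fu : Filter (nbhs u) by exact: nbhs_filter.
apply: (cvg_big (@add_continuous R)) => k _.
apply: cvgM.
  exact: (continuous_comp (cf u) (@coord_continuous _ _ _ _ _ _)).
exact: (continuous_comp (cg u) (@coord_continuous _ _ _ _ _ _)).
Qed.

Lemma mulmxr_continuous {R : realType} {m n p} (A : 'M[R]_(n, p)) :
  continuous (fun u : 'M[R]_(m, n) => u *m A).
Proof. exact: (linear_mx_continuous (mulmxr A)). Qed.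

(* The minimum mu of the Rayleigh quotient is an eigenvalue: A - mu is positive
   semidefinite and its form vanishes at the minimizer. *)
Lemma lambda_min_le {R : realType} {m} (A : 'M[R]_m) (v : 'rV[R]_m) :
  A^T = A -> lambda_min A * dot v v <= dot (v *m A) v.
Proof.
move=> As; have [->|v0] := eqVneq v 0; first by rewrite mul0mx !dot0l mulr0.
pose S : set 'rV[R]_m := [set u | dot u u = 1].
have normalized u : u != 0 -> S ((enorm u)^-1 *: u).
  move=> /enorm_gt0 u0; rewrite /S /= dotZl dotZr -sqr_enorm.
  by field; rewrite gt_eqF.
(* The Euclidean unit sphere is closed, and bounded in the sup norm because each squared coordinate
   is at most [dot u u]. *)
have cS : compact S.
  apply: bounded_closed_compact.
    exists 1; split => // M M1 u Su; apply: ltW; apply: le_lt_trans M1.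
    rewrite [leLHS]/Num.norm /= mx_normrE; apply/bigmax_leP; split => //= -[i j] _ /=.
    rewrite (ord1 i) -(@expr_le1 _ 2)// real_normK ?num_real//.
    by rewrite -Su /dot (bigD1 j)//= -expr2 lerDl; apply: sumr_ge0 => k _; rewrite -expr2 sqr_ge0.
  apply: (@preimage_closed _ R (fun u : 'rV[R]_m => dot u u) [set 1]).
    have cdot : continuous (fun u : 'rV[R]_m => dot u u).
      by apply: dot_continuous => u; exact: cvg_id.
    by move=> u _; exact: cdot.
  exact: closed_eq.
have [||c] := @EVT_min_rV R m (fun u => dot (u *m A) u) S _ cS.
- by exists ((enorm v)^-1 *: v); exact: normalized.
- apply: continuous_subspaceT; apply: dot_continuous; first exact: mulmxr_continuous.
  by move=> u; exact: cvg_id.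
rewrite inE => Sc cmin; set mu := dot (c *m A) c in cmin *.
have mu_le u : mu * dot u u <= dot (u *m A) u.
  have [->|u0] := eqVneq u 0; first by rewrite mul0mx !dot0l mulr0.
  have := cmin _ (mem_set (normalized _ u0)).
  rewrite -scalemxAl dotZl dotZr -sqr_enorm mulrA -expr2 -ler_pdivrMl.
    by rewrite -exprVn invrK mulrC.
  by rewrite exprn_gt0// invr_gt0 enorm_gt0.
suff mu_eig : eigenvalue A mu.
  apply: le_trans (mu_le v); apply: ler_wpM2r; first exact: dot_ge0.
  (* The infimum is a lower bound only if the spectrum is bounded below; [mu] itself bounds it, by
     [mu_le] at an eigenvector. *)
  apply: ge_inf => //; exists mu => a /eigenvalueP[w wA w0].
  have := mu_le w; rewrite wA dotZl ler_pM2r//.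
  by rewrite -sqr_enorm exprn_gt0// enorm_gt0.
apply/eigenvalueP; exists c; last first.
  by apply/eqP => c0; move: Sc; rewrite c0 /S /= dot0l => /eqP; rewrite eq_sym oner_eq0.
have := @psd_ker _ _ (A - mu%:M) c; rewrite mulmxBr mul_mx_scalar => /(_ _ _ _)/eqP.
rewrite subr_eq0 => H; apply/eqP; apply: H.
- by rewrite linearB /= As tr_scalar_mx.
- by move=> u; rewrite mulmxBr mul_mx_scalar dotBl dotZl subr_ge0.
- by rewrite dotBl dotZl Sc mulr1 subrr.
Qed.

(** Makes the [sup] in [opnorm] a genuine supremum. The bound is the Frobenius norm, by
    Cauchy-Schwarz on each row of [A]. *)
Lemma opnorm_has_ubound {R : realType} {m p} (A : 'M[R]_(m, p)) :
  has_ubound [set enorm (v *m A^T) | v in [set v : 'rV[R]_p | enorm v <= 1]].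
Proof.
exists (Num.sqrt (\sum_i enorm (row i A) ^+ 2)) => _ [v /= v1 <-].
apply: ler_wsqrtr; apply: ler_sum => i _; rewrite -expr2.
have -> : (v *m A^T) ord0 i = dot v (row i A).
  by rewrite mxE; apply: eq_bigr => k _; rewrite !mxE.
rewrite -(real_normK (num_real _)); apply: lerXn2r; rewrite ?nnegrE ?enorm_ge0//.
apply: le_trans (dot_le_enorm _ _) _.
by rewrite ler_piMl ?enorm_ge0.
Qed.

Lemma opnorm_ge0 {R : realType} {m p} (A : 'M[R]_(m, p)) : 0 <= opnorm A.
Proof.
apply: (le_trans (enorm_ge0 (0 *m A^T))); apply: ub_le_sup; first exact: opnorm_has_ubound.
by exists 0 => //=; rewrite /enorm dot0l sqrtr0.
Qed.

Lemma enorm_mul_le {R : realType} {m p} (A : 'M[R]_(m, p)) v :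
  enorm (v *m A^T) <= opnorm A * enorm v.
Proof.
have [->|/enorm_gt0 v0] := eqVneq v 0.
  by rewrite mul0mx /enorm !dot0l sqrtr0 mulr0.
rewrite -ler_pdivrMr// mulrC -[_^-1]ger0_norm ?invr_ge0 ?enorm_ge0// -enormZ scalemxAl.
apply: ub_le_sup; first exact: opnorm_has_ubound.
by exists ((enorm v)^-1 *: v) => //=; rewrite enormZ ger0_norm ?invr_ge0 ?enorm_ge0// mulVf ?gt_eqF.
Qed.

Lemma dot_mul_opnorm {R : realType} {m p} (A : 'M[R]_(m, p)) u v :
  `|dot (v *m A^T) u| <= opnorm A * enorm v * enorm u.
Proof.
by apply: le_trans (dot_le_enorm _ _) _; rewrite ler_wpM2r ?enorm_ge0 ?enorm_mul_le.
Qed.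

(** * Differential calculus *)

(** The difference quotients on the two sides are the same function of the increment, hence so are
    their limits. *)
Lemma derive_comp_affine {R : realType} {V1 V2 W : normedModType R}
  (f : V2 -> W) (L : {linear V1 -> V2}) c x v :
  'D_v (fun u => f (L u + c)) x = 'D_(L v) f (L x + c).
Proof.
rewrite /derive; set F := (X in lim (X @ _) = _); set G := (X in _ = lim (X @ _)).
suff -> : F = G by [].
by apply/funext => h; rewrite /F /G /= [L _]linearD [L (h *: v)]linearZ addrA.
Qed.

Lemma differentiable_comp_affine {R : realType} {m n} {W : normedModType R}
  (f : 'rV[R]_n -> W) (L : {linear 'rV[R]_m -> 'rV[R]_n}) c x :
  differentiable f (L x + c) -> differentiable (fun u => f (L u + c)) x.
Proof.
move=> df; apply: (@differentiable_comp _ _ _ _ (fun u => L u + c) f); last exact: df.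
apply: differentiableD; last exact: differentiable_cst.
exact/linear_differentiable/linear_mx_continuous.
Qed.

Lemma is_derive_line {R : realType} {m} {W : normedModType R}
  (f : 'rV[R]_m -> W) x v (t : R) : differentiable f (x + t *: v) ->
  is_derive t (1 : R) (fun s : R => f (x + s *: v)) ('d f (x + t *: v) v).
Proof.
move=> df.
have dl : is_diff t (fun s : R => x + s *: v) (fun s : R => s *: v).
  apply: is_diff_eq; apply/funext => s; rewrite /= fctE.
  by rewrite add0r.
have dfl : differentiable (fun s : R => f (x + s *: v)) t.
  by apply: (@differentiable_comp _ _ _ _ (fun s : R => x + s *: v) f).
apply: DeriveDef; first exact: diff_derivable.
rewrite deriveE// (@diff_comp _ _ _ _ (fun s : R => x + s *: v) f)//=.
by rewrite diff_val scale1r.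
Qed.

Lemma MVT_line {R : realType} {m} (f : 'rV[R]_m -> R^o) x v :
  (forall u, differentiable f u) ->
  exists2 c : R, 0 <= c <= 1 & f (x + v) - f x = 'd f (x + c *: v) v.
Proof.
move=> df.
have dl (t : R) := is_derive_line _ x v _ (df (x + t *: v)).
have [|c] := @MVT_segment R _ _ 0 1 ler01 (fun t _ => dl t).
  apply: derivable_within_continuous => t _; exact: (@ex_derive _ _ _ _ _ _ _ (dl t)).
rewrite in_itv /= => c01; rewrite scale1r scale0r addr0 subr0 mulr1 => E.
by exists c.
Qed.

Lemma diff_grad {R : realType} {m} (g : 'rV[R]_m -> R^o) x v :
  differentiable g x -> 'd g x v = dot (grad g x) v.
Proof.
move=> dg; rewrite {1}[v]row_sum_delta linear_sum; apply: eq_bigr => k _.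
by rewrite linearZ mxE deriveE// mulrC.
Qed.

(** Pairing with a fixed [w] turns a vector-valued map into a scalar one, to which [MVT_line]
    applies. *)
Lemma differentiable_dot {R : realType} {V : normedModType R} {m}
  (f : V -> 'rV[R]_m) w x : differentiable f x ->
  differentiable (fun u => dot (f u) w : R^o) x /\
  forall v, 'd (fun u => dot (f u) w : R^o) x v = dot ('d f x v) w.
Proof.
move=> df.
have lw : linear (fun u => dot u w : R^o) by move=> a u v; rewrite dotDl dotZl.
pose lwM := GRing.isLinear.Build _ _ _ _ _ lw.
pose L : {linear 'rV[R]_m -> R^o} := HB.pack (fun u => dot u w : R^o) lwM.
have cL := linear_mx_continuous L.
have dL : differentiable L (f x) by exact: linear_differentiable.
split; first exact: (@differentiable_comp _ _ _ _ f L).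
move=> v; have := @diff_comp _ _ _ _ f L x df dL.
by rewrite (@diff_lin _ _ _ L (f x) cL) => E; rewrite E.
Qed.

(** Two uses of the mean value theorem: for u |-> g (u + s b) - g u along s a, then for u |-> <grad
    g u, s a> along s b. Each contributes one factor s. *)
Lemma second_difference {R : realType} {m} (g : 'rV[R]_m -> R^o) x a b (s : R) :
  (forall u, differentiable g u) -> (forall u, differentiable (grad g) u) ->
  exists c c' : R, [/\ 0 <= c <= 1, 0 <= c' <= 1 &
    g (x + s *: a + s *: b) - g (x + s *: a) - (g (x + s *: b) - g x) =
    s ^+ 2 * dot (b *m (Jac (grad g) (x + s *: (c *: a + c' *: b)))^T) a].
Proof.
move=> dg dgg.
have dgs u : differentiable (fun u => g (u + s *: b)) u.
  exact: (@differentiable_comp_affine _ _ _ _ g idfun).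
have dd u : differentiable (fun u => g (u + s *: b) - g u) u.
  exact: differentiableB.
have [c c01] := MVT_line _ x (s *: a) dd.
set y := x + c *: (s *: a).
have dE : 'd (fun u => g (u + s *: b) - g u : R^o) y (s *: a)
    = dot (grad g (y + s *: b)) (s *: a) - dot (grad g y) (s *: a).
  rewrite -(deriveE _ (dd y)).
  have -> := deriveB (@diff_derivable _ _ _ _ _ (s *: a) (dgs y))
                     (@diff_derivable _ _ _ _ _ (s *: a) (dg y)).
  have -> : 'D_(s *: a) (fun u => g (u + s *: b)) y = 'D_(s *: a) g (y + s *: b).
    exact: (@derive_comp_affine _ _ _ _ g idfun).
  rewrite (deriveE _ (dg y)) (deriveE _ (dg _)).
  by congr (_ - _); exact: diff_grad.
rewrite {}dE => E.
have dpsi u := differentiable_dot (grad g) (s *: a) u (dgg u).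
have [c' c'01 E'] := MVT_line _ y (s *: b) (fun u => (dpsi u).1).
exists c, c'; split => //.
rewrite {}E {}E' (dpsi _).2 [_ (s *: b)]linearZ dotZl dotZr mulrA -expr2 /Jac trmxK.
have <- : y + c' *: (s *: b) = x + s *: (c *: a + c' *: b).
  by rewrite /y scalerDr !scalerA addrA ![s * _]mulrC.
by rewrite -(deriveEjacobian b (dgg _)) (deriveE b (dgg _)).
Qed.

Lemma dot_delta {R : realType} {m} (u : 'rV[R]_m) k : dot u (delta_mx ord0 k) = u ord0 k.
Proof.
rewrite /dot (bigD1 k)//= big1 => [|j jk]; first by rewrite mxE !eqxx mulr1 addr0.
by rewrite mxE (negbTE jk) andbF mulr0.
Qed.

(* Both iterated derivatives are limits of the same second difference quotient. *)
Lemma hessian_sym {R : realType} {m} (g : 'rV[R]_m -> R^o) x :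
  C2 g -> (hessian g x)^T = hessian g x.
Proof.
move=> [dg [dgg cK]]; rewrite /hessian; set K := Jac (grad g) in cK *.
pose h a b z := dot (b *m (K z)^T) a.
suff H a b : h a b x = h b a x.
  apply/matrixP => k l; have := H (delta_mx ord0 l) (delta_mx ord0 k).
  by rewrite /h !dot_delta -!rowE !mxE.
have ch a' b' : continuous (h a' b').
  apply: dot_continuous; last exact: cst_continuous.
  move=> z; apply: (@continuous_comp _ _ _ K (fun M => b' *m M^T)); first exact: cK.
  exact: (linear_mx_continuous (mulmx b' \o trmx)).
apply/eqP; rewrite -subr_eq0 -normr_eq0; apply/negP => /negP e0.
(* Half the supposed gap: a common value closer than this to both numbers contradicts the triangle
   inequality. *)
have {}e0 : 0 < `|h a b x - h b a x| / 2 by rewrite divr_gt0// lt_neqAle eq_sym e0 normr_ge0.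
move: (ch a b x) (ch b a x) => /cvgrPdist_lt/(_ _ e0) H1 /cvgrPdist_lt/(_ _ e0) H2.
have [d /= d0 Hd] := (nbhs_ballP _ _).1 (filterI H1 H2).
have n0 : 0 < 1 + `|a| + `|b| by rewrite -addrA ltr_pwDl// addr_ge0.
(* This step keeps all the intermediate points in the ball of radius [d]; the added 1 makes the
   denominator positive and the inequality strict. *)
pose s := d / (1 + `|a| + `|b|).
have s0 : 0 < s by rewrite divr_gt0.
have near c c' a' b' : 0 <= c <= 1 -> 0 <= c' <= 1 -> `|a'| + `|b'| = `|a| + `|b| ->
    ball x d (x + s *: (c *: a' + c' *: b')).
  move=> /andP[c0 c1] /andP[c'0 c'1] ab; rewrite -ball_normE /ball_ /= opprD addNKr normrN normrZ.
  rewrite gtr0_norm// /s mulrAC ltr_pdivrMr// ltr_pM2l//.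
  apply: (le_lt_trans (ler_normD _ _)); rewrite !normrZ !ger0_norm//.
  rewrite -addrA -ab ltr_pwDl//.
  by rewrite lerD// ler_piMl.
have [c [c' [c01 c'01 E]]] := second_difference g x a b s dg dgg.
have [k [k' [k01 k'01 E']]] := second_difference g x b a s dg dgg.
have := Hd _ (near _ _ a b c01 c'01 erefl) => -[/= A _].
have := Hd _ (near _ _ b a k01 k'01 (addrC _ _)) => -[/= _ B].
(* The second difference is symmetric in [a] and [b]; cancel s^2. *)
have : h a b (x + s *: (c *: a + c' *: b)) = h b a (x + s *: (k *: b + k' *: a)).
  have s2 : s ^+ 2 != 0 by rewrite expf_neq0// gt_eqF.
  apply: (mulfI s2); rewrite /h -E -E' addrAC opprB opprB.
  by rewrite [x + s *: b + _]addrAC; ring.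
move=> hE; move: A B; rewrite hE => A B.
move: A B; set w := h b a _; move: (h a b x) (h b a x) w => p q w A.
rewrite distrC => B; have := le_lt_trans (ler_distD w p q) (ltrD A B).
by rewrite -splitr ltxx.
Qed.

(** * Continuous differentiability and Jacobians under linear maps and sums *)

Lemma C1_comp_lin {R : realType} {m n p} (f : 'rV[R]_n -> 'rV[R]_p)
  (L : {linear 'rV[R]_m -> 'rV[R]_n}) : C1 f -> C1 (f \o L).
Proof.
move=> [df cf].
have dL x : differentiable L x by exact/linear_differentiable/linear_mx_continuous.
have dfL x : differentiable (f \o L) x by exact: differentiable_comp.
split => //; have -> : Jac (f \o L) = (fun x => Jac f (L x) *m (lin1_mx L)^T).
  apply/funext => x; rewrite /Jac -trmx_mul; congr trmx.
  apply/row_matrixP => i; rewrite !rowE mulmxA mul_rV_lin1 -!deriveEjacobian//.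
  rewrite !deriveE// (@diff_comp _ _ _ _ L f)//=.
  by rewrite (@diff_lin _ _ _ L x (linear_mx_continuous L)) mul_rV_lin1.
move=> x.
have := @continuous_comp _ _ _ (Jac f \o L) (mulmxr (lin1_mx L)^T) x; apply.
  by apply: (@continuous_comp _ _ _ L (Jac f)); [exact: (linear_mx_continuous L)|exact: cf].
exact: mulmxr_continuous.
Qed.

Lemma C1_lin_comp {R : realType} {m n p} (L : {linear 'rV[R]_n -> 'rV[R]_p})
  (f : 'rV[R]_m -> 'rV[R]_n) : C1 f -> C1 (L \o f).
Proof.
move=> [df cf].
have dL x : differentiable L x by exact/linear_differentiable/linear_mx_continuous.
have dfL x : differentiable (L \o f) x by exact: differentiable_comp.
split => //; have -> : Jac (L \o f) = (fun x => (lin1_mx L)^T *m Jac f x).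
  apply/funext => x; rewrite /Jac -trmx_mul; congr trmx.
  apply/row_matrixP => i; rewrite !rowE mulmxA -!deriveEjacobian// mul_rV_lin1.
  rewrite !deriveE// (@diff_comp _ _ _ _ f L)//=.
  by rewrite (@diff_lin _ _ _ L (f x) (linear_mx_continuous L)).
move=> x; apply: (@continuous_comp _ _ _ (Jac f) (mulmx (lin1_mx L)^T)); first exact: cf.
exact: (linear_mx_continuous (mulmx (lin1_mx L)^T)).
Qed.

Lemma jacobian_sum {R : realType} {m n k} (f : 'I_k -> 'rV[R]_m -> 'rV[R]_n) x :
  (forall i, differentiable (f i) x) ->
  jacobian (fun x => \sum_i f i x) x = \sum_i jacobian (f i) x.
Proof.
move=> df; have -> : (fun x => \sum_i f i x) = \sum_i f i.
  by apply/funext => z; rewrite fct_sumE.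
apply/row_matrixP => j; rewrite !rowE mulmx_sumr.
apply: (etrans (esym (deriveEjacobian (delta_mx ord0 j) (differentiable_sum df)))).
have -> := @derive_sum _ _ _ _ f x (delta_mx ord0 j)
  (fun i => @diff_derivable _ _ _ _ _ _ (df i)).
by apply: eq_bigr => i _; exact: deriveEjacobian (df i).
Qed.

Lemma C1_sum {R : realType} {m n k} (f : 'I_k -> 'rV[R]_m -> 'rV[R]_n) :
  (forall i, C1 (f i)) -> C1 (fun x => \sum_i f i x).
Proof.
move=> Cf; split=> x.
  have -> : (fun x => \sum_i f i x) = \sum_i f i.
    by apply/funext => z; rewrite fct_sumE.
  by apply: differentiable_sum => i; case: (Cf i).
have -> : Jac (fun x => \sum_i f i x) = (fun x => \sum_i Jac (f i) x).
  apply/funext => z; rewrite /Jac jacobian_sum => [|i]; last by case: (Cf i).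
  by rewrite linear_sum.
have Fx : Filter (nbhs x) by exact: nbhs_filter.
by apply: (cvg_big add_continuous) => i _; case: (Cf i) => _; exact.
Qed.

Lemma jacobian_comp_affine {R : realType} {m n p q} (f : 'rV[R]_n -> 'rV[R]_p)
  (M : {linear 'rV[R]_p -> 'rV[R]_q}) (L : {linear 'rV[R]_m -> 'rV[R]_n}) c x v :
  differentiable f (L x + c) ->
  v *m jacobian (fun u => M (f (L u + c))) x = M ('d f (L x + c) (L v)).
Proof.
move=> df.
have dM w : differentiable M w by exact/linear_differentiable/linear_mx_continuous.
have dfL := @differentiable_comp_affine _ _ _ _ f L c x df.
have dMfL : differentiable (M \o (fun u => f (L u + c))) x.
  by apply: differentiable_comp; [exact: dfL|exact: dM].
rewrite -(deriveEjacobian v dMfL) (deriveE v dMfL).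
have -> := @diff_comp _ _ _ _ _ M x dfL (dM _).
rewrite /= (@diff_lin _ _ _ M _ (linear_mx_continuous M)) -(deriveE v dfL).
by rewrite -(deriveE (L v) df); congr (M _); exact: derive_comp_affine.
Qed.

(** * Quadratic forms on a network *)

Lemma dot_mxvec {R : realType} {m n} (A B : 'M[R]_(m, n)) :
  dot (mxvec A) (mxvec B) = \sum_i dot (row i A) (row i B).
Proof.
rewrite /dot pair_big /= (reindex _ (curry_mxvec_bij _ _)) /=.
by apply: eq_bigr => -[i j] _; rewrite !mxvecE !mxE.
Qed.

(** Common to both network weights: the own-strategy part is bounded player by player, which leaves
    only the coupling term to estimate. *)
Lemma network_form_split {R : realType} {N n} (P : 'M[R]_N) (A K : 'I_N -> 'M[R]_n)
  (v : 'I_N -> 'rV[R]_n) k1 :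
  (forall i u, k1 * dot u u <= dot (u *m A i) u) ->
  k1 * \sum_i dot (v i) (v i) + \sum_i dot ((\sum_j P i j *: v j) *m (K i)^T) (v i) <=
  \sum_i dot (v i *m (A i)^T + (\sum_j P i j *: v j) *m (K i)^T) (v i).
Proof.
move=> hA; rewrite mulr_sumr -big_split /=; apply: ler_sum => i _.
by rewrite dotDl lerD2r dot_mulmx trmxK dotC.
Qed.

Lemma network_form_ge {R : realType} {N n} (P : 'M[R]_N) (A K : 'I_N -> 'M[R]_n)
  (v : 'I_N -> 'rV[R]_n) k1 k2 :
  (forall i j, 0 <= P i j) -> (forall i u, k1 * dot u u <= dot (u *m A i) u) ->
  (forall i, opnorm (K i) <= k2) -> 0 <= k2 ->
  (k1 - k2 * opnorm P) * \sum_i dot (v i) (v i) <=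
  \sum_i dot (v i *m (A i)^T + (\sum_j P i j *: v j) *m (K i)^T) (v i).
Proof.
move=> P0 hA hK k20; apply: le_trans (network_form_split _ _ _ _ _ hA).
rewrite mulrBl lerD2l -mulrA.
(* The vector of block norms has the norm of the stacked vector, so the coupling is compared with
   the scalar form of [P] at [q]. *)
pose q := \row_i enorm (v i).
have -> : \sum_i dot (v i) (v i) = enorm q ^+ 2.
  by rewrite sqr_enorm; apply: eq_bigr => i _; rewrite mxE -sqr_enorm expr2.
apply: (@le_trans _ _ (- (k2 * dot (q *m P^T) q))).
  rewrite lerN2; apply: ler_wpM2l => //; rewrite expr2 mulrA.
  exact: le_trans (ler_norm _) (dot_mul_opnorm _ _ _).
(* Compare the terms of each pair (i, j); since P i j >= 0, it factors out of the bound on the term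
   in [K i]. *)
rewrite /dot mulr_sumr -sumrN; apply: ler_sum => i _; rewrite -/(dot _ _).
rewrite !mxE mulr_suml mulr_sumr -sumrN mulmx_suml dot_suml; apply: ler_sum => j _.
rewrite !mxE -scalemxAl dotZl lerNl -mulrN.
have -> : k2 * (enorm (v j) * P i j * enorm (v i)) =
  P i j * (k2 * enorm (v j) * enorm (v i)) by ring.
apply: ler_wpM2l => //; apply: (le_trans (ler_norm _)); rewrite normrN.
apply: (le_trans (dot_mul_opnorm _ _ _)).
by apply: ler_wpM2r; rewrite ?enorm_ge0//; apply: ler_wpM2r; rewrite ?enorm_ge0.
Qed.

Lemma network_form_ge_sym {R : realType} {N n} (P : 'M[R]_N) (A K : 'I_N -> 'M[R]_n)
  (v : 'I_N -> 'rV[R]_n) k1 k2 :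
  P^T = P -> (forall i u, k1 * dot u u <= dot (u *m A i) u) ->
  (forall i, K i = k2%:M) -> 0 <= k2 ->
  (k1 - k2 * `|lambda_min P|) * \sum_i dot (v i) (v i) <=
  \sum_i dot (v i *m (A i)^T + (\sum_j P i j *: v j) *m (K i)^T) (v i).
Proof.
move=> Ps hA hK k20; apply: le_trans (network_form_split _ _ _ _ _ hA).
rewrite mulrBl lerD2l -mulrA -mulrN.
(* The k-th coordinates of all the blocks: with every [K i] equal to [k2] times the identity, the
   coupling separates into one form of [P] for each k. *)
pose c k := \row_i v i ord0 k.
have -> : \sum_i dot (v i) (v i) = \sum_k dot (c k) (c k).
  rewrite /dot exchange_big; apply: eq_bigr => k _.
  by apply: eq_bigr => i _; rewrite mxE.
have -> : \sum_i dot ((\sum_j P i j *: v j) *m (K i)^T) (v i) = k2 * \sum_k dot (c k *m P) (c k).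
  transitivity (\sum_i \sum_k k2 * ((\sum_j P i j * v j ord0 k) * v i ord0 k)).
    apply: eq_bigr => i _; rewrite hK tr_scalar_mx mul_mx_scalar dotZl /dot mulr_sumr.
    apply: eq_bigr => k _; rewrite summxE; congr (_ * (_ * _)).
    by apply: eq_bigr => j _; rewrite mxE.
  rewrite exchange_big mulr_sumr; apply: eq_bigr => k _; rewrite -mulr_sumr.
  congr (_ * _); apply: eq_bigr => i _; rewrite !mxE; congr (_ * _).
  by apply: eq_bigr => j _; rewrite mxE mulrC -{1}Ps mxE.
apply: ler_wpM2l => //; rewrite mulr_sumr -sumrN; apply: ler_sum => k _.
apply: le_trans (lambda_min_le P (c k) Ps); rewrite -mulNr; apply: ler_wpM2r; first exact: dot_ge0.
by rewrite lerNl -normrN ler_norm.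
Qed.

(** Lets the [sup] defining [kappa2], and by negation the [inf] defining [kappa1], bound every
    member of their families. *)
Lemma range_has_ubound {R : realType} {I : finType} (f : I -> R) : has_ubound (range f).
Proof.
exists (\sum_i `|f i|) => _ [i _ <-]; apply: (le_trans (ler_norm _)).
by rewrite (bigD1 i)//= lerDl sumr_ge0.
Qed.

Lemma range_has_lbound {R : realType} {I : finType} (f : I -> R) : has_lbound (range f).
Proof.
have [M hM] := range_has_ubound (fun i => - f i).
by exists (- M) => _ [i _ <-]; rewrite lerNl; apply: hM; exists i.
Qed.

Lemma convex_profiles {R : realType} {N n} (X : 'I_N -> set 'rV[R]_n) x y (t : R) :
  polyhedral X -> profiles X x -> profiles X y -> 0 <= t <= 1 ->
  profiles X (x + t *: (y - x)).
Proof.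
move=> pX hx hy /andP[t0 t1] i; move: (hx i) (hy i).
have -> : block (x + t *: (y - x)) i = (1 - t) *: block x i + t *: block y i.
  by rewrite /block !(linearD, linearZ, linearN) /= scalerBl scalerBr scale1r addrA addrAC.
move: (block x i) (block y i) => u v.
have [m [p [B [b [H [h [-> _]]]]]]] := pX i => -[Bu Hu] [Bv Hv].
split=> [k|].
  have -> : (B *m ((1 - t) *: u + t *: v)^T) k ord0
      = (1 - t) * (B *m u^T) k ord0 + t * (B *m v^T) k ord0.
    by rewrite linearD !linearZ mulmxDr -!scalemxAr 3!mxE [in LHS]mxE.
  rewrite -[leRHS]mul1r -[in leRHS](subrK t 1) [leRHS]mulrDl.
  by apply: lerD; apply: ler_wpM2l; rewrite ?subr_ge0.
by rewrite linearD !linearZ mulmxDr -!scalemxAr Hu Hv -scalerDl subrK scale1r.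
Qed.

(** The map u |-> [u; z] is affine, and its linear part sends the k-th basis vector to the k-th one
    of the larger space. *)
Lemma grad_partial {R : realType} {m p} (G : 'rV[R]_(m + p) -> R^o) u z :
  grad (fun u => G (row_mx u z)) u = lsubmx (grad G (row_mx u z)).
Proof.
apply/rowP => k; rewrite !mxE.
pose L : {linear 'rV[R]_m -> 'rV[R]_(m + p)} := mulmxr (row_mx 1%:M 0).
have LE w c : L w + row_mx 0 c = row_mx w c.
  by rewrite /= mul_mx_row mulmx1 mulmx0 add_row_mx addr0 add0r.
have -> : (fun u => G (row_mx u z)) = (fun u => G (L u + row_mx 0 z)).
  by apply/funext => w; rewrite LE.
have -> := @derive_comp_affine R _ _ _ G L (row_mx 0 z) u (delta_mx ord0 k).
rewrite LE; congr ('D_ _ _ _); rewrite /L /= mul_mx_row mulmx1 mulmx0.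
apply/rowP => j; rewrite !mxE; case: splitP => l jl; rewrite !mxE.
  by have -> : j = lshift p l; [exact: val_inj | rewrite eq_lshift].
by have -> : j = rshift m l; [exact: val_inj | rewrite eq_rlshift andbF].
Qed.

(** Split the direction as [v; 0] + [0; w]: the differential of [grad G], cut to its first block,
    yields the Hessian along the first summand and the mixed derivative along the second. *)
Lemma hess_row {R : realType} {m p} (G : 'rV[R]_(m + p) -> R^o) u z v w :
  differentiable (grad G) (row_mx u z) ->
  lsubmx ('d (grad G) (row_mx u z) (row_mx v w)) =
  v *m (hessian (fun u => G (row_mx u z)) u)^T +
  w *m (Jac (fun z => grad (fun u => G (row_mx u z)) u) z)^T.
Proof.
move=> dG; rewrite /hessian /Jac !trmxK.
pose L : {linear 'rV[R]_m -> 'rV[R]_(m + p)} := mulmxr (row_mx 1%:M 0).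
pose L' : {linear 'rV[R]_p -> 'rV[R]_(m + p)} := mulmxr (row_mx 0 1%:M).
have LE v' : L v' = row_mx v' 0 by rewrite /= mul_mx_row mulmx1 mulmx0.
have LE' v' : L' v' = row_mx 0 v' by rewrite /= mul_mx_row mulmx1 mulmx0.
have -> : grad (fun u => G (row_mx u z)) = (fun u => lsubmx (grad G (L u + row_mx 0 z))).
  by apply/funext => u'; rewrite LE add_row_mx addr0 add0r grad_partial.
have -> : (fun z => grad (fun u => G (row_mx u z)) u)
    = (fun z => lsubmx (grad G (L' z + row_mx u 0))).
  by apply/funext => z'; rewrite LE' add_row_mx addr0 add0r grad_partial.
have E1 : L u + row_mx 0 z = row_mx u z by rewrite LE add_row_mx addr0 add0r.
have E2 : L' z + row_mx u 0 = row_mx u z by rewrite LE' add_row_mx addr0 add0r.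
have -> := @jacobian_comp_affine _ _ _ _ _ (grad G) (@lsubmx R 1 m p) L (row_mx 0 z) u v.
  have -> := @jacobian_comp_affine _ _ _ _ _ (grad G) (@lsubmx R 1 m p) L' (row_mx u 0) z w.
    rewrite E1 E2 LE LE' -linearD -[_ + 'd _ _ _]linearD add_row_mx addr0 add0r.
    by [].
  by rewrite E2.
by rewrite E1.
Qed.

(** * The game operator *)

(** The point [x^i; z^i(x)] at which a joint cost is evaluated, as a linear function of the
    profile. *)
Definition block_aggregate {R : realType} {N n : nat} (P : 'M[R]_N) (i : 'I_N)
  (x : 'rV[R]_(N * n)) : 'rV[R]_(n + n) := row_mx (block x i) (aggregate P x i).

Lemma block_is_linear {R : realType} {N n : nat} (i : 'I_N) :
  linear (fun x : 'rV[R]_(N * n) => block x i).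
Proof. by move=> a u v; rewrite /block !linearP. Qed.

Lemma block_aggregate_is_linear {R : realType} {N n : nat} (P : 'M[R]_N) (i : 'I_N) :
  linear (@block_aggregate R N n P i).
Proof.
move=> a u v; rewrite /block_aggregate scale_row_mx add_row_mx; congr row_mx.
  exact: block_is_linear.
rewrite /aggregate scaler_sumr -big_split; apply: eq_bigr => j _.
by rewrite block_is_linear scalerDr !scalerA mulrC.
Qed.

HB.instance Definition _ (R : realType) (N n : nat) (P : 'M[R]_N) (i : 'I_N) :=
  GRing.isLinear.Build R 'rV[R]_(N * n) 'rV[R]_(n + n) *:%R (block_aggregate P i)
    (block_aggregate_is_linear P i).

(** Injection of the i-th block, adjoint to [block] by [dot_stack1]. As a composite of linear maps
    it inherits its linear structure. *)
Definition stack1 {R : realType} {N n : nat} (i : 'I_N) : 'rV[R]_n -> 'rV[R]_(N * n) :=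
  mxvec \o mulmx (delta_mx i ord0 : 'cV[R]_N).

HB.instance Definition _ (R : realType) (N n : nat) (i : 'I_N) :=
  GRing.Linear.on (@stack1 R N n i).

Lemma row_delta_mul {R : realType} {N n : nat} (i j : 'I_N) (u : 'rV[R]_n) :
  row j (delta_mx i ord0 *m u) = (j == i)%:R *: u.
Proof. by apply/rowP => k; rewrite !mxE big_ord1 !mxE eqxx andbT. Qed.

Lemma stackE {R : realType} {N n : nat} (u : 'I_N -> 'rV[R]_n) :
  stack u = \sum_i stack1 i (u i).
Proof.
rewrite /stack /stack1 /= -linear_sum; congr mxvec; apply/row_matrixP => j.
rewrite rowK linear_sum (bigD1 j)//= row_delta_mul eqxx scale1r.
by rewrite big1 ?addr0// => i ij; rewrite row_delta_mul eq_sym (negbTE ij) scale0r.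
Qed.

Lemma dot_stack1 {R : realType} {N n : nat} (i : 'I_N) (u : 'rV[R]_n) (v : 'rV[R]_(N * n)) :
  dot (stack1 i u) v = dot u (block v i).
Proof.
rewrite -[v in LHS]vec_mxK dot_mxvec (bigD1 i)//= row_delta_mul eqxx scale1r.
by rewrite big1 ?addr0// => j ij; rewrite row_delta_mul (negbTE ij) scale0r dot0l.
Qed.

Lemma dot_block {R : realType} {N n : nat} (v : 'rV[R]_(N * n)) :
  dot v v = \sum_i dot (block v i) (block v i).
Proof. by rewrite -[v in LHS]vec_mxK dot_mxvec. Qed.

Section game.
Context {R : realType} {N n : nat} (P : 'M[R]_N) {d : 'I_N -> nat}
  (J : forall i : 'I_N, 'rV[R]_n -> 'rV[R]_n -> 'rV[R]_(d i) -> R)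
  (y : forall i : 'I_N, 'rV[R]_(d i)).

Let G i : 'rV[R]_(n + n) -> R^o := fun w => J i (lsubmx w) (rsubmx w) (y i).

Lemma joint_costE i z : (fun u => J i u z (y i)) = (fun u => G i (row_mx u z)).
Proof. by apply/funext => u; rewrite /G row_mxKl row_mxKr. Qed.

(** Each summand is a joint gradient between two linear maps, so both regularity and the Jacobian
    follow from the chain rule. *)
Lemma game_operatorE : game_operator P J y =
  fun x => \sum_i (stack1 i \o lsubmx) (grad (G i) (block_aggregate P i x)).
Proof.
apply/funext => x; rewrite /game_operator stackE; apply: eq_bigr => i _.
by rewrite /= -grad_partial joint_costE.
Qed.

Lemma C1_game_operator : (forall i, C1 (grad (G i))) -> C1 (game_operator P J y).
Proof.
move=> CG; rewrite game_operatorE; apply: C1_sum => i.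
exact: (C1_lin_comp (stack1 i \o lsubmx) _ (C1_comp_lin _ (block_aggregate P i) (CG i))).
Qed.

Lemma game_form x v : (forall i, C1 (grad (G i))) ->
  dot (v *m jacobian (game_operator P J y) x) v =
  \sum_i dot (block v i *m (hess_xx P J y x i)^T +
    (\sum_j P i j *: block v j) *m (hess_xz P J y x i)^T) (block v i).
Proof.
move=> CG; rewrite game_operatorE jacobian_sum => [|i]; last first.
  by case: (C1_lin_comp (stack1 i \o lsubmx) _ (C1_comp_lin _ (block_aggregate P i) (CG i))).
rewrite mulmx_sumr dot_suml; apply: eq_bigr => i _.
have [dG _] := CG i.
have -> : (fun x => (stack1 i \o lsubmx) (grad (G i) (block_aggregate P i x))) =
    (fun x => (stack1 i \o lsubmx) (grad (G i) (block_aggregate P i x + 0))).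
  by apply/funext => z; rewrite addr0.
have -> := @jacobian_comp_affine _ _ _ _ _ (grad (G i))
  (stack1 i \o lsubmx) (block_aggregate P i) 0 x v (dG _).
rewrite /= dot_stack1 addr0 /block_aggregate hess_row; last exact: dG.
have -> : hess_xx P J y x i =
    hessian (fun u => G i (row_mx u (aggregate P x i))) (block x i).
  by rewrite /hess_xx joint_costE.
suff -> : hess_xz P J y x i =
    Jac (fun z => grad (fun u => G i (row_mx u z)) (block x i)) (aggregate P x i) by [].
rewrite /hess_xz; have -> // : (fun z => grad (fun u => J i u z (y i)) (block x i)) =
    (fun z => grad (fun u => G i (row_mx u z)) (block x i)).
by apply/funext => z; rewrite joint_costE.
Qed.

Lemma alpha_const_le (X : 'I_N -> set 'rV[R]_n) x : 0 < alpha_const P X J y ->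
  profiles X x ->
  alpha_const P X J y <= kappa1 P J y x - kappa2 P J y x * network_weight P X J y.
Proof.
rewrite /alpha_const => a0 Xx; apply: ge_inf; last by exists x.
(* Without a lower bound, [inf] would take its default value 0, against [a0]. *)
by apply: contrapT => nlb; move: a0; rewrite inf_out ?ltxx// => -[].
Qed.

Lemma game_form_ge (X : 'I_N -> set 'rV[R]_n) x v : (0 < N)%N ->
  (forall i j, 0 <= P i j) -> (forall i, C1 (grad (G i))) ->
  (forall i, C2 (fun u => J i u (aggregate P x i) (y i))) ->
  0 < alpha_const P X J y -> profiles X x ->
  alpha_const P X J y * dot v v <= dot (v *m jacobian (game_operator P J y) x) v.
Proof.
move=> N0 P0 CG CJ a0 Xx; rewrite game_form// dot_block.
apply: le_trans (ler_wpM2r _ (alpha_const_le X x a0 Xx)) _.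
  by apply: sumr_ge0 => i _; exact: dot_ge0.
have h1 i u : kappa1 P J y x * dot u u <= dot (u *m hess_xx P J y x i) u.
  apply: le_trans (lambda_min_le _ _ (hessian_sym _ _ (CJ i))).
  apply: ler_wpM2r; first exact: dot_ge0.
  by apply: ge_inf; [exact: range_has_lbound|exists i].
have h2 i : opnorm (hess_xz P J y x i) <= kappa2 P J y x.
  by apply: ub_le_sup; [exact: range_has_ubound|exists i].
(* Player 0 exists because N > 0, and its operator norm is nonnegative. *)
have h3 : 0 <= kappa2 P J y x := le_trans (opnorm_ge0 _) (h2 (Ordinal N0)).
rewrite /network_weight; case: asboolP => [[Ps hK]|_].
  by apply: network_form_ge_sym => // i; exact: hK.
exact: network_form_ge.
Qed.

End game.

Theorem theorem2 (R : realType) (N n : nat) (N_gt0 : (0 < N)%N) (n_gt0 : (0 < n)%N)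
  (P : 'M[R]_N) (P_ge0 : forall i j, 0 <= P i j) (P_diag : forall i, P i i = 0)
  (X : 'I_N -> set 'rV[R]_n)
  (d : 'I_N -> nat) (Y : forall i, set 'rV[R]_(d i))
  (J : forall i : 'I_N, 'rV[R]_n -> 'rV[R]_n -> 'rV[R]_(d i) -> R)
  (A1 : polyhedral X) (A2 : regular_costs P X Y J) :
  forall y : (forall i : 'I_N, 'rV[R]_(d i)), (forall i, Y i (y i)) ->
    C1 (game_operator P J y) /\
    (0 < alpha_const P X J y ->
     strongly_monotone (profiles X) (game_operator P J y) (alpha_const P X J y)).
Proof.
move=> y Yy.
have CG i := (A2 i (y i) (Yy i)).2.2.
have CF := C1_game_operator P J y CG; split=> // a0.
set F := game_operator P J y in CF *; set a := alpha_const P X J y in a0 *.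
have form_ge x v : profiles X x -> a * dot v v <= dot (v *m jacobian F x) v.
  move=> Xx; apply: game_form_ge => // i.
  by have [+ _] := A2 i (y i) (Yy i); move=> /(_ x)[].
split=> // [x1 x2 Xx1 Xx2|x Xx v].
  (* Apply the mean value theorem to u |-> <F u, x1 - x2> from [x2] to [x1]; by convexity the
     intermediate point is a profile, where [form_ge] applies. *)
  have dphi u := differentiable_dot F (x1 - x2) u (CF.1 u).
  have [c c01] := MVT_line _ x2 (x1 - x2) (fun u => (dphi u).1).
  rewrite [x2 + (x1 - x2)]addrC subrK -dotBl (dphi _).2 => ->.
  rewrite sqr_enorm -(deriveE _ (CF.1 _)) (deriveEjacobian _ (CF.1 _)).
  by apply: form_ge; exact: convex_profiles.
(* A matrix and its transpose have the same quadratic form, so the symmetric part has the form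
   bounded by [form_ge]. *)
rewrite mulmxBr mul_mx_scalar dotBl dotZl -scalemxAr dotZl mulmxDr dotDl.
rewrite [in X in X + _]dot_mulmx [dot v _]dotC /Jac trmxK.
have := form_ge x v Xx.
by move: (dot (v *m jacobian F x) v) (a * dot v v) => p q; lra.
Qed.
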